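(* Let $G$ be a finite abelian group and let $\rho:\mathfrak S\to\mathsf E$ be a graded connected map, where $\mathfrak S=\bigsqcup_{n\ge0}\mathfrak S_n$. Let $\rho_G:\mathsf G\to\mathsf E(G)$ be the induced graded connected map on $\mathsf G=\bigsqcup_{n\ge0}G_n$. (i) If $\rho$ has the induction property (IP), then $\rho_G$ has the induction property (IP). (ii) If $\rho$ has the restriction property (RP), then $\rho_G$ has the restriction property (RP).
   Context: $G_n=G^n\rtimes\mathfrak S_n$ is the wreath product; its elements are written $\sigma^{\mathbf g}=\sigma\cdot(g_1,\dots,g_n)$ and identified with coloured words $\sigma(1)^{g_1}\cdots\sigma(n)^{g_n}$; multiplication is determined by $\sigma\cdot(g_1,\dots,g_n)=(g_{\sigma^{-1}(1)},\dots,g_{\sigma^{-1}(n)})\cdot\sigma$; $\mathfrak S_n\subseteq G_n$ via trivial colours, so $\tau\sigma^{\mathbf g}=(\tau\sigma)^{\mathbf g}$ for $\tau\in\mathfrak S_n$. $S_n=\{s_1,\dots,s_{n-1}\}$, $s_i=(i,i+1)$. For $\sigma\in\mathfrak S_n$, $\tau\in\mathfrak S_m$, $\sigma\times\tau\in\mathfrak S_{n+m}$ maps $a\in[1,n]$ to $\sigma(a)$ and $n+b$ to $n+\tau(b)$; $\sigma^{\mathbf g}\times\tau^{\mathbf h}=(\sigma\times\tau)^{\mathbf g\cdot\mathbf h}$. $X_{(n,m)}$ is the set of $u\in\mathfrak S_{n+m}$ increasing on $[1,n]$ and on $[n+1,n+m]$. Let $H$ be $G$ or the trivial group (for which $H_n=\mathfrak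 S_n$), and $\mathsf H=\bigsqcup_n H_n$. A graded set is $\mathsf E=\bigsqcup_{n\ge0}E_n$; a graded map $\rho:\mathsf H\to\mathsf E$ satisfies $\rho(H_n)\subseteq E_n$. It is connected if every fibre of $\rho$ in each $H_n$ is left-connected: any two elements $\alpha,\beta$ of the fibre are joined by a sequence $\alpha=x_1,\dots,x_k=\beta$ in the fibre with $x_{j+1}x_j^{-1}\in S_n$ for all $j<k$. (IP) for $\rho:\mathsf H\to\mathsf E$: for any $n,m\in\mathbb{N}$ and $(e_n,e_m)\in E_n\times E_m$ there is $X\subseteq E_{n+m}$ such that $\{u(\alpha\times\beta):u\in X_{(n,m)},\ \alpha\in H_n,\ \rho(\alpha)=e_n,\ \beta\in H_m,\ \rho(\beta)=e_m\}=\bigsqcup_{e\in X}\rho^{-1}(e)$. (RP) for $\rho:\mathsf H\to\mathsf E$: for any $n,m\in\mathbb{N}$ and $u\in X_{(n,m)}$, if $\alpha_1,\alpha_2\in H_n$, $\beta_1,\beta_2\in H_m$ satisfy $\rho(\alpha_1)=\rho(\alpha_2)$ and $\rho(\beta_1)=\rho(\beta_2)$, then $\rho((\alpha_1\times\beta_1)u^{-1})=\rho((\alpha_2\times\beta_2)u^{-1})$. The rainbow decomposition of $\sigma^{\mathbf g}$ is the unique factorization $\sigma^{\mathbf g}=\sigma_1^{g_1}\cdots\sigma_k^{g_k}$ of the coloured word into nonempty monochromatic words with $g_i\ne g_{i+1}$. Definition of $\rho_G$: for $\sigma^{\mathbf g}\in G_n$ and $s_i\in S_n$, let $\sigma_\nu$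 (resp. $\sigma_\mu$) be the factor of the rainbow decomposition containing the letter $i$ (resp. $i+1$). Put $\sigma^{\mathbf g}\,\dot\sim^G_\rho\,s_i\sigma^{\mathbf g}$ iff $\nu\ne\mu$, or $\nu=\mu$ and $\rho(s_i\sigma)=\rho(\sigma)$. Let $\sim^G_\rho$ be the reflexive transitive closure (an equivalence relation on each $G_n$), $E_n(G)=G_n/\!\sim^G_\rho$, $\mathsf E(G)=\bigsqcup_nE_n(G)$, and $\rho_G:\mathsf G\to\mathsf E(G)$ the projection. *)

(* Defs.v *)
From HB Require Import structures.
From Stdlib Require Import Relations.
From mathcomp Require Import all_boot all_fingroup.
From mathcomp Require Import boolp classical_sets.

Set Implicit Arguments.
Unset Strict Implicit.
Unset Printing Implicit Defensive.

Local Open Scope group_scope.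

(* [Wreath s g] is the element s.(g_1, ..., g_n), i.e. the coloured word
   s(1)^{g_1} ... s(n)^{g_n}: colours are attached to positions.
   Positions and letters are numbered from 0. *)
Record wreath (gT : finGroupType) (n : nat) :=
  Wreath { wperm : 'S_n; wcol : {ffun 'I_n -> gT} }.

Section WreathGroup.
Variables (gT : finGroupType) (n : nat).
Implicit Types x y z : wreath gT n.

Definition wreath_to_pair x := (wperm x, wcol x).
Definition pair_to_wreath (p : 'S_n * {ffun 'I_n -> gT}) := Wreath p.1 p.2.
Lemma wreath_to_pairK : cancel wreath_to_pair pair_to_wreath.
Proof. by case. Qed.

HB.instance Definition _ := Finite.copy (wreath gT n) (can_type wreath_to_pairK).

(* (s.g)(t.h) = (st).(g_{t(i)} h_i)_i, where st is the composite "t first".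
   MathComp's product of permutations composes in the opposite order:
   (a * b) i = b (a i), so st is written t * s. *)
Definition wreath_mul x y : wreath gT n :=
  Wreath (wperm y * wperm x) [ffun i => wcol x (wperm y i) * wcol y i].
Definition wreath_one : wreath gT n := Wreath 1 [ffun=> 1].
Definition wreath_inv x : wreath gT n :=
  Wreath (wperm x)^-1 [ffun i => (wcol x ((wperm x)^-1 i))^-1].

Lemma wreath_mulA : associative wreath_mul.
Proof.
move=> x y z; congr Wreath => /=; first by rewrite mulgA.
by apply/ffunP=> i; rewrite !ffunE permM mulgA.
Qed.

Lemma wreath_mul1 : left_id wreath_one wreath_mul.
Proof.
case=> s g; congr Wreath => /=; first by rewrite mulg1.
by apply/ffunP=> i; rewrite !ffunE mul1g.
Qed.

Lemma wreath_mulV : left_inverse wreath_one wreath_inv wreath_mul.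
Proof.
case=> s g; congr Wreath => /=; first by rewrite mulgV.
by apply/ffunP=> i; rewrite !ffunE permK mulVg.
Qed.

HB.instance Definition _ :=
  Finite_isGroup.Build (wreath gT n) wreath_mulA wreath_mul1 wreath_mulV.

Definition wsym (s : 'S_n) : wreath gT n := Wreath s [ffun=> 1].
Definition wbase (g : {ffun 'I_n -> gT}) : wreath gT n := Wreath 1 g.

Lemma wreath_mulE x y : x * y =
  Wreath (wperm y * wperm x) [ffun i => wcol x (wperm y i) * wcol y i].
Proof. by []. Qed.

Lemma wsym_mul s t : wsym (t * s) = wsym s * wsym t.
Proof.
rewrite wreath_mulE; congr Wreath.
by apply/ffunP=> i; rewrite !ffunE mulg1.
Qed.

Lemma wsym_base s g : wsym s * wbase g = Wreath s g.
Proof.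
rewrite wreath_mulE; congr Wreath; rewrite /= ?mul1g //.
by apply/ffunP=> i; rewrite !ffunE mul1g.
Qed.

Lemma wreath_commutation s (g : {ffun 'I_n -> gT}) :
  wsym s * wbase g = wbase [ffun i => g (s^-1 i)] * wsym s.
Proof.
rewrite wsym_base wreath_mulE; congr Wreath; rewrite /= ?mulg1 //.
by apply/ffunP=> i; rewrite !ffunE permK mulg1.
Qed.

Lemma wsym_mulE s x : wsym s * x = Wreath (wperm x * s) (wcol x).
Proof.
rewrite wreath_mulE; congr Wreath.
by apply/ffunP=> i; rewrite !ffunE mul1g.
Qed.

End WreathGroup.

Arguments wsym {gT n}.
Arguments wbase {gT n}.

Definition simple_refl (n : nat) : {set 'S_n} :=
  [set s : 'S_n | [exists i : 'I_n, exists j : 'I_n,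
     (j == i.+1 :> nat) && (s == tperm i j)]].

Section DirectProduct.
Variables (n m : nat).

Definition perm_prod_fun (s : 'S_n) (t : 'S_m) (k : 'I_(n + m)) : 'I_(n + m) :=
  match split k with inl a => lshift m (s a) | inr b => rshift n (t b) end.

Lemma perm_prod_fun_inj s t : injective (perm_prod_fun s t).
Proof.
apply: (@can_inj _ _ _ (perm_prod_fun s^-1 t^-1)) => k.
rewrite /perm_prod_fun; case: (split_ordP k) => a ->.
  have splitl b : split (lshift m b) = inl b by exact: (unsplitK (inl b)).
  by rewrite !splitl permK.
have splitr b : split (rshift n b) = inr b by exact: (unsplitK (inr b)).
by rewrite !splitr permK.
Qed.

Definition perm_prod s t : 'S_(n + m) := perm (@perm_prod_fun_inj s t).

Definition wprod (gT : finGroupType) (x : wreath gT n) (y : wreath gT m) :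
    wreath gT (n + m) :=
  Wreath (perm_prod (wperm x) (wperm y))
    [ffun k => match split k with inl a => wcol x a | inr b => wcol y b end].

Definition shuffles : {set 'S_(n + m)} :=
  [set u : 'S_(n + m) |
    [forall i : 'I_n, forall j : 'I_n,
       (i < j) ==> (u (lshift m i) < u (lshift m j))] &&
    [forall i : 'I_m, forall j : 'I_m,
       (i < j) ==> (u (rshift n i) < u (rshift n j))]].

End DirectProduct.

Section GradedMaps.
Variables (hT : finGroupType) (E : nat -> Type).
Variable rho : forall n, wreath hT n -> E n.

Definition left_step n (x y : wreath hT n) : bool :=
  y * x^-1 \in [set wsym s | s in simple_refl n].

Definition left_connected n (A : set (wreath hT n)) : Prop :=
  forall x y, A x -> A y -> exists p : seq (wreath hT n),
    [/\ path (@left_step n) x p, last x p = y & forall z, z \in p -> A z].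

Definition graded_connected : Prop :=
  forall n (e : E n), left_connected [set x | @rho n x = e]%classic.

Definition induction_property : Prop :=
  forall n m (e1 : E n) (e2 : E m), exists X : set (E (n + m)),
    [set w | exists u a b,
       [/\ u \in shuffles n m, @rho n a = e1, @rho m b = e2
         & w = wsym u * wprod a b]]%classic
    = (\bigcup_(e in X) [set w | @rho (n + m) w = e])%classic.

Definition restriction_property : Prop :=
  forall n m (u : 'S_(n + m)), u \in shuffles n m ->
  forall (a1 a2 : wreath hT n) (b1 b2 : wreath hT m),
    rho a1 = rho a2 -> rho b1 = rho b2 ->
    rho (wprod a1 b1 * (wsym u)^-1) = rho (wprod a2 b2 * (wsym u)^-1).

End GradedMaps.

Lemma unit_mulA : associative (fun _ _ : unit => tt). Proof. by []. Qed.
Lemma unit_mul1 : left_id tt (fun _ _ : unit => tt). Proof. by case. Qed.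
Lemma unit_mulV : left_inverse tt (fun _ : unit => tt) (fun _ _ : unit => tt).
Proof. by []. Qed.
HB.instance Definition _ := Finite_isGroup.Build unit unit_mulA unit_mul1 unit_mulV.

(* A graded map on the symmetric groups, seen on the wreath products by the
   trivial group through the identification wperm : wreath unit n -> 'S_n. *)
Definition on_trivial (E : nat -> Type) (rho : forall n, 'S_n -> E n) (n : nat)
  (x : wreath unit n) : E n := rho n (wperm x).

Section RainbowWord.
Variables (L C : eqType).

(* A monochromatic word is a pair (letters, colour). *)
Fixpoint rainbow_word (w : seq (L * C)) : seq (seq L * C) :=
  if w is (l, c) :: w' then
    if rainbow_word w' is (ls, c') :: d then
      if c == c' then (l :: ls, c) :: d else ([:: l], c) :: (ls, c') :: d
    else [:: ([:: l], c)]
  else [::].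

Definition is_rainbow (w : seq (L * C)) (d : seq (seq L * C)) : Prop :=
  [/\ flatten [seq [seq (l, f.2) | l <- f.1] | f <- d] = w,
      all (fun f : seq L * C => f.1 != [::]) d
    & sorted (fun f f' : seq L * C => f.2 != f'.2) d].

Lemma rainbow_wordP w : is_rainbow w (rainbow_word w).
Proof.
elim: w => [|[l c] w] //=.
case: (rainbow_word w) => [|[ls c'] d] [/= <-] d_ne d_s; first by split.
case: eqP => [->|/eqP cc']; last by split; rewrite //= cc'.
split=> //=; first by case/andP: d_ne.
by case: d d_s {d_ne}.
Qed.

Lemma rainbow_word_uniq w d : is_rainbow w d -> d = rainbow_word w.
Proof.
elim: w d => [|[l c] w IHw] [|[[|l' ls] c'] d] [] //= [<- <- def_w] d_ne d_s.
case: ls => [|l2 ls] /= in def_w d_s *.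
  have <- : d = rainbow_word w by apply: IHw; split=> //; exact: path_sorted d_s.
  by case: d {def_w d_ne} d_s => [|[ls c2] d] //= /andP [/negPf-> _].
have <- : (l2 :: ls, c') :: d = rainbow_word w.
  by apply: IHw; split=> //; case: d d_s {def_w d_ne}.
by rewrite eqxx.
Qed.

End RainbowWord.

Section Rainbow.
Variables (gT : finGroupType) (E : nat -> Type).
Variable rho : forall n, 'S_n -> E n.
Variable n : nat.
Implicit Types x y : wreath gT n.

Definition coloured_word x : seq ('I_n * gT) :=
  [seq (wperm x k, wcol x k) | k <- enum 'I_n].

Definition rainbow x : seq (seq 'I_n * gT) := rainbow_word (coloured_word x).

(* Index in the rainbow decomposition of the factor containing the letter l. *)
Definition rainbow_index x (l : 'I_n) : nat :=
  find (fun f : seq 'I_n * gT => l \in f.1) (rainbow x).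

(* As in wreath_mul, wperm x * tperm i j is the composite s_i sigma that
   applies sigma = wperm x first. *)
Definition rainbow_step x y : Prop :=
  exists i j : 'I_n,
    [/\ j = i.+1 :> nat, y = wsym (tperm i j) * x
      & rainbow_index x i <> rainbow_index x j \/
        rainbow_index x i = rainbow_index x j /\
        rho (wperm x * tperm i j) = rho (wperm x)].

Definition rainbow_rel x y : bool :=
  `[< clos_refl_trans (wreath gT n) rainbow_step x y >].

Lemma rainbow_word_map (T L L' C : eqType) (w : seq T) (f : T -> L) (c : T -> C)
    (h : L -> L') :
  rainbow_word [seq (h (f k), c k) | k <- w] =
  [seq (map h b.1, b.2) | b <- rainbow_word [seq (f k, c k) | k <- w]].
Proof.
elim: w => //= k w ->.
by case: (rainbow_word _) => //= -[ls c'] d /=; case: eqP.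
Qed.

Lemma rainbow_index_step x (s : 'S_n) l :
  rainbow_index (wsym s * x) (s l) = rainbow_index x l.
Proof.
rewrite /rainbow_index /rainbow /coloured_word wsym_mulE /=.
under eq_map do rewrite permM.
rewrite (rainbow_word_map _ (wperm x) (wcol x) s) find_map.
by apply: eq_find => -[ls c] /=; rewrite mem_map //; exact: perm_inj.
Qed.

Lemma rainbow_step_sym x y : rainbow_step x y -> rainbow_step y x.
Proof.
move=> [i [j [ij -> Hx]]]; exists i, j; split=> //.
  by rewrite !wsym_mulE /= -mulgA tperm2 mulg1; case: x {Hx}.
have Ei := rainbow_index_step x (tperm i j) i; rewrite tpermL in Ei.
have Ej := rainbow_index_step x (tperm i j) j; rewrite tpermR in Ej.
rewrite Ei Ej wsym_mulE /= -mulgA tperm2 mulg1.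
by case: Hx => [/nesym|[-> ->]]; [left | right].
Qed.

Lemma rainbow_rel_refl : reflexive rainbow_rel.
Proof. by move=> x; apply/asboolP; exact: rt_refl. Qed.

Lemma rainbow_rel_sym : symmetric rainbow_rel.
Proof.
suff sub x y : rainbow_rel x y -> rainbow_rel y x.
  by move=> x y; apply/idP/idP; exact: sub.
move=> /asboolP xy; apply/asboolP.
elim: xy => {x y} [x y /rainbow_step_sym|x|x y z _ yx _ zy].
- exact: rt_step.
- exact: rt_refl.
- exact: rt_trans zy yx.
Qed.

Lemma rainbow_rel_trans : transitive rainbow_rel.
Proof.
by move=> y x z /asboolP xy /asboolP yz; apply/asboolP; exact: rt_trans xy yz.
Qed.

Canonical rainbow_equiv :=
  EquivRel rainbow_rel rainbow_rel_refl rainbow_rel_sym rainbow_rel_trans.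

Definition rainbow_quot := {eq_quot rainbow_equiv}%qT.

Definition rainbow_proj x : rainbow_quot := (\pi_({eq_quot rainbow_equiv}) x)%qT.

Lemma rainbow_projP x y : rainbow_proj x = rainbow_proj y <->
  clos_refl_trans (wreath gT n) rainbow_step x y.
Proof.
split=> [/eqquotP /asboolP //|xy].
by apply/eqquotP/asboolP.
Qed.

End Rainbow.

Lemma rainbow_proj_connected (gT : finGroupType) (E : nat -> Type)
    (rho : forall n, 'S_n -> E n) :
  graded_connected (@rainbow_proj gT E rho).
Proof.
move=> n e x y /= <- /esym/rainbow_projP /clos_rt_rt1n_iff.
elim=> {y} [x'|x' y z [i [j [ij def_y Hx]]] _ [p [yp <- p_fib]]].
  by exists [::].
have pxy : rainbow_proj rho y = rainbow_proj rho x'.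
  by apply/esym/rainbow_projP/rt_step; exists i, j.
exists (y :: p); split=> //=.
  rewrite yp andbT /left_step def_y mulgK; apply: imset_f.
  by rewrite inE; apply/existsP; exists i; apply/existsP; exists j; rewrite ij !eqxx.
by move=> z'; rewrite inE => /predU1P [->|/p_fib ->].
Qed.

(* Main.v *)
Require Import Defs.
From Stdlib Require Import Relations.
From mathcomp Require Import all_boot all_fingroup zify.
From mathcomp Require Import boolp classical_sets.

(** Left multiplication by a permutation moves the letters of a coloured word
    and leaves the colours at their positions.  So the rainbow factors are
    fixed intervals of positions: two letters lie in the same factor iff the
    colour is constant between their positions ([rainbow_index_eqP]).  This
    criterion is inherited by coloured subwords, and this is all that has to
    be known about colours: what remains is to check that the generating
    steps of the rainbow equivalence are compatible with shuffles and
    products, and each step is either free (distinct factors) or governed by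
    [rho] itself.

    Induction.  Let [w = u (a x b)] with [u] a shuffle, and consider a step
    exchanging the letters [i], [i+1] of [w].  If these letters come from
    different halves, the exchange turns [u] into another shuffle and keeps
    [a] and [b].  If both come from [a], say from the letters [p] and [q],
    then [q = p+1] because [u] is increasing, and the exchange amounts to
    exchanging [p] and [q] in [a].  This is a step for [a]: the factors of [a]
    are the traces of those of [w] on the first half, and if the step of [w]
    required an equality of values of [rho], the induction property of [rho]
    together with the uniqueness of the decomposition [u (a x b)] gives the
    same equality for [a] ([induction_property_fibre]).

    Restriction.  It suffices to change one of [a], [b] by one step, say to
    exchange the letters [i], [i+1] of [a].  The word [(a x b) u^-1] contains
    [a] as a coloured subword, with the same letters, so that the same letters
    get exchanged.  If they lie in distinct factors of the large word, this is
    a step; otherwise they lie in one factor of [a], so the exchange preserves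
    [rho] of [a], and the restriction property of [rho] applies. *)

Set Implicit Arguments.
Unset Strict Implicit.
Unset Printing Implicit Defensive.

Local Open Scope group_scope.

(** * Rainbow factors as maximal monochromatic intervals *)

Section RainbowFactors.
Variables (L C : eqType).

(** A new factor starts exactly where the colour changes, so the index of the
    factor of a letter counts the colour changes before its position.
    Distinctness of the letters makes the search stop at this position. *)
Lemma find_rainbow_word (w : seq (L * C)) (x0 : L * C) (p : nat) :
  uniq [seq e.1 | e <- w] -> p < size w ->
  find (fun f : seq L * C => (nth x0 w p).1 \in f.1) (rainbow_word w) =
  \sum_(0 <= k < p) ((nth x0 w k).2 != (nth x0 w k.+1).2).
Proof.
elim: w p => [|[l c] w IHw] //= p /andP [lw w_uniq].
case: p => [_|p] /=; last rewrite ltnS => p_lt.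
  rewrite big_geq //; case: (rainbow_word w) => [|[ls c'] d] /=; first by rewrite inE eqxx.
  by case: eqP => _ /=; rewrite inE eqxx.
rewrite big_nat_recl //= -(IHw p w_uniq p_lt).
have neq_l : (nth x0 w p).1 != l.
  by apply: contraNneq lw => <-; apply/map_f/mem_nth.
move: (nth x0 w p).1 neq_l => l' neq_l.
case: w {IHw w_uniq lw} p_lt => [|[l1 c1] w] //= p_lt.
case: (rainbow_word w) => [|[ls c'] d].
  by case: (eqVneq c c1) => /= _; rewrite !inE (negPf neq_l).
by case: (eqVneq c1 c') => [->|_];
  case: eqVneq => /= _; rewrite !inE (negPf neq_l).
Qed.

End RainbowFactors.

Section SameFactor.
Variables (gT : finGroupType) (n : nat).
Implicit Types x : wreath gT n.

Lemma rainbow_index_posE x (p : 'I_n) :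
  rainbow_index x (wperm x p) =
  \sum_(0 <= k < p) ((nth (p, wcol x p) (coloured_word x) k).2
                  != (nth (p, wcol x p) (coloured_word x) k.+1).2).
Proof.
rewrite -find_rainbow_word; first last.
- by rewrite size_map size_enum_ord.
- by rewrite -map_comp map_inj_uniq ?enum_uniq // => i j /perm_inj.
by apply: eq_find => f; rewrite (nth_map p) ?size_enum_ord // nth_ord_enum.
Qed.

(** The number of colour changes before [q] minus that before [p] counts the
    changes between [p] and [q]; it vanishes iff the colour is constant
    there. *)
Lemma rainbow_index_eqP x (p q : 'I_n) : p <= q ->
  rainbow_index x (wperm x p) = rainbow_index x (wperm x q) <->
  (forall k : 'I_n, p <= k <= q -> wcol x k = wcol x p).
Proof.
move=> pq.
have colE e (k : 'I_n) : (nth e (coloured_word x) k).2 = wcol x k.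
  by rewrite (nth_map p) ?size_enum_ord // nth_ord_enum.
set F := fun k => (nth (q, wcol x q) (coloured_word x) k).2.
have FE (k : 'I_n) : F k = wcol x k by exact: colE.
have -> : rainbow_index x (wperm x p) = \sum_(0 <= k < p) (F k != F k.+1).
  rewrite rainbow_index_posE; apply: eq_big_nat => k /andP [_ kp].
  have kn : k.+1 < n by exact: leq_ltn_trans kp (ltn_ord p).
  by rewrite -[k.+1]/(val (Ordinal kn)) -[k]/(val (Ordinal (ltnW kn))) !colE !FE.
rewrite rainbow_index_posE (big_cat_nat _ pq) //=.
(* [S] counts the colour changes from [p] to [q]. *)
set S := (X in _ = addn _ X); split.
  move/eqP; rewrite -{1}[X in X == _]addn0 eqn_add2l eq_sym => /eqP S0.
  have step k : p <= k < q -> F k = F k.+1.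
    move=> pkq; move/eqP: S0; rewrite sum_nat_seq_eq0 => /allP/(_ k).
    by rewrite mem_index_iota pkq eqb0 negbK => /(_ isT)/eqP.
  move=> k /andP [pk kq]; rewrite -!FE.
  have: forall d, p + d <= q -> F (p + d)%N = F p.
    elim=> [|d IHd]; first by rewrite addn0.
    by rewrite addnS => dq; rewrite -step ?leq_addr // IHd // ltnW.
  by move/(_ (k - p)%N); rewrite subnKC // => /(_ kq).
move=> mono; rewrite -[LHS]addn0; congr addn; apply/esym/eqP.
rewrite sum_nat_seq_eq0; apply/allP => k; rewrite mem_index_iota => /andP [pk kq].
have kn : k.+1 < n by exact: leq_ltn_trans kq (ltn_ord q).
have /= Fk := FE (Ordinal (ltnW kn)); have /= Fk1 := FE (Ordinal kn).
suff eqF : F k = F k.+1 by rewrite /= eqb0 negbK; apply/eqP.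
by rewrite Fk Fk1 !mono //= ?pk ?(ltnW kq) // (leqW pk) kq.
Qed.

End SameFactor.

(** * Coloured subwords *)

(** Here [x] is a coloured subword of [y]: [f] sends the positions of [x] to
    positions of [y], and [h] renames its letters accordingly. *)
Section Subword.
Variables (gT : finGroupType) (n N : nat).
Variables (x : wreath gT n) (y : wreath gT N) (f h : 'I_n -> 'I_N).
Hypothesis f_incr : {homo f : i j / i < j}.
Hypothesis f_col : forall p, wcol y (f p) = wcol x p.
Hypothesis f_letter : forall p, wperm y (f p) = h (wperm x p).

Let f_ndecr (i j : 'I_n) : i <= j -> f i <= f j.
Proof. by rewrite leq_eqVlt => /predU1P [/val_inj -> //|/f_incr/ltnW]. Qed.

(** If the colour is constant between two positions of the image of [f], it is
    constant on the part of this interval that comes from [x]. *)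
Lemma subword_same_factor i j :
  rainbow_index y (h i) = rainbow_index y (h j) ->
  rainbow_index x i = rainbow_index x j.
Proof.
rewrite -(permKV (wperm x) i) -(permKV (wperm x) j).
move: ((wperm x)^-1 i) ((wperm x)^-1 j) => p q; rewrite -!f_letter.
wlog pq : p q / p <= q.
  by move=> W; case/orP: (leq_total p q) => /W // E /esym/E/esym.
move/(rainbow_index_eqP _ (f_ndecr pq)) => mono.
apply/(rainbow_index_eqP _ pq) => k /andP [pk kq].
by rewrite -!f_col mono // !f_ndecr.
Qed.

(** [x] is a factor of [y], so that a monochromatic interval of [x] meets no
    foreign position in [y]. *)
Hypothesis f_convex : forall (p q : 'I_n) (k : 'I_N),
  f p <= k <= f q -> exists k0, k = f k0.

Lemma factor_same_factor i j :
  rainbow_index x i = rainbow_index x j ->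
  rainbow_index y (h i) = rainbow_index y (h j).
Proof.
rewrite -(permKV (wperm x) i) -(permKV (wperm x) j).
move: ((wperm x)^-1 i) ((wperm x)^-1 j) => p q; rewrite -!f_letter.
wlog pq : p q / p <= q.
  by move=> W; case/orP: (leq_total p q) => /W // E /esym/E/esym.
move/(rainbow_index_eqP _ pq) => mono.
have f_cancel (a b : 'I_n) : f a <= f b -> a <= b.
  by apply: contraTT; rewrite -!ltnNge; apply: f_incr.
apply/(rainbow_index_eqP _ (f_ndecr pq)) => k pkq.
have [k0 def_k] := f_convex pkq; move: pkq; rewrite {}def_k !f_col.
by case/andP=> /f_cancel pk /f_cancel kq; rewrite mono // pk.
Qed.

End Subword.

(** * Shuffles and direct products *)

(** A letter strictly between [i] and [j] would be sent strictly between two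
    consecutive values. *)
Lemma incr_succ n N (f : 'I_n -> 'I_N) (i j : 'I_n) :
  {homo f : i j / i < j} -> f j = (f i).+1 :> nat -> j = i.+1 :> nat.
Proof.
move=> f_incr fij.
have ij : i < j.
  case: (ltngtP i j) => // [/f_incr|/val_inj ij]; first by rewrite fij ltnNge leqnSn.
  by move/eqP: fij; rewrite ij -{1}[nat_of_ord _]addn0 -addn1 eqn_add2l.
apply/eqP; rewrite eqn_leq ij andbT leqNgt; apply/negP => ij2.
have kn := ltn_trans ij2 (ltn_ord j).
have := @f_incr i (Ordinal kn) (ltnSn _); have := @f_incr (Ordinal kn) j ij2.
by rewrite fij ltnS leqNgt => /negPf ->.
Qed.

Lemma incr_perm1 n (c : 'S_n) : {homo c : i j / i < j} -> c = 1.
Proof.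
(* An increasing permutation moves no point down; apply this to [c] and its inverse. *)
have expand (d : 'S_n) : {homo d : i j / i < j} -> forall i : 'I_n, i <= d i.
  move=> d_incr [i]; elim: i => [|i IHi] i_lt //=.
  by apply: leq_ltn_trans (IHi (ltnW i_lt)) _; apply: d_incr; rewrite /= ltnSn.
move=> c_incr.
have cV_incr : {homo c^-1 : i j / i < j}.
  move=> i j; apply: contraTT; rewrite -!leqNgt leq_eqVlt.
  by case/predU1P=> [/val_inj/perm_inj -> //|/c_incr]; rewrite !permKV => /ltnW.
apply/permP => i; rewrite perm1; apply/val_inj/eqP; rewrite eqn_leq expand // andbT.
by have := expand _ cV_incr (c i); rewrite permK.
Qed.

(** No value lies strictly between [i] and [j], so that any third value
    compares with both in the same way. *)
Lemma tperm_succ_lt N (i j v w : 'I_N) : j = i.+1 :> nat ->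
  v < w -> ~~ ((v == i) && (w == j)) -> tperm i j v < tperm i j w.
Proof.
rewrite -!val_eqE /= => ij vw not_ij.
have neqv (a b : 'I_N) : a <> b -> a <> b :> nat by move=> ne /val_inj.
case: (tpermP i j v) => [def_v|def_v|/neqv vi /neqv vj];
  case: (tpermP i j w) => [def_w|def_w|/neqv wi /neqv wj]; subst; lia.
Qed.

Section Product.
Variables (n m : nat).

Lemma perm_prodL (s : 'S_n) (t : 'S_m) i :
  perm_prod s t (lshift m i) = lshift m (s i).
Proof. by rewrite permE /perm_prod_fun (unsplitK (inl i)). Qed.

Lemma perm_prodR (s : 'S_n) (t : 'S_m) i :
  perm_prod s t (rshift n i) = rshift n (t i).
Proof. by rewrite permE /perm_prod_fun (unsplitK (inr i)). Qed.

Lemma perm_prodM (s s' : 'S_n) (t t' : 'S_m) :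
  perm_prod (s * s') (t * t') = perm_prod s t * perm_prod s' t'.
Proof.
apply/permP => k; rewrite permM.
by case: (split_ordP k) => i ->; rewrite ?perm_prodL ?perm_prodR permM.
Qed.

Lemma perm_prod1 : perm_prod (1 : 'S_n) (1 : 'S_m) = 1.
Proof.
apply/permP => k.
by case: (split_ordP k) => i ->; rewrite ?perm_prodL ?perm_prodR !perm1.
Qed.

Lemma perm_prod_tpermL (i j : 'I_n) :
  perm_prod (tperm i j) (1 : 'S_m) = tperm (lshift m i) (lshift m j).
Proof.
apply/permP => k; case: (split_ordP k) => a ->.
  by rewrite perm_prodL (inj_tperm _ _ _ (@lshift_inj n m)).
by rewrite perm_prodR perm1 tpermD // eq_lrshift.
Qed.

Lemma perm_prod_tpermR (i j : 'I_m) :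
  perm_prod (1 : 'S_n) (tperm i j) = tperm (rshift n i) (rshift n j).
Proof.
apply/permP => k; case: (split_ordP k) => a ->.
  by rewrite perm_prodL perm1 tpermD // eq_rlshift.
by rewrite perm_prodR (inj_tperm _ _ _ (@rshift_inj n m)).
Qed.

Lemma shufflesP (u : 'S_(n + m)) : reflect
  ({homo (fun i => u (lshift m i)) : i j / i < j} /\
   {homo (fun i => u (rshift n i)) : i j / i < j}) (u \in shuffles n m).
Proof.
rewrite inE; apply: (iffP andP) => -[uL uR]; split.
- by move=> i j; move/forallP/(_ i)/forallP/(_ j)/implyP: uL.
- by move=> i j; move/forallP/(_ i)/forallP/(_ j)/implyP: uR.
- by apply/forallP=> i; apply/forallP=> j; apply/implyP; apply: uL.
- by apply/forallP=> i; apply/forallP=> j; apply/implyP; apply: uR.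
Qed.

(** An increasing sequence is determined by the set of its values. *)
Lemma incr_reparam1 k (f g : 'I_k -> 'I_(n + m)) (c : 'S_k) :
  {homo f : i j / i < j} -> {homo g : i j / i < j} ->
  (forall i, g i = f (c i)) -> c = 1.
Proof.
move=> f_incr g_incr gE; apply: incr_perm1 => i j ij.
have := g_incr i j ij; rewrite !gE.
by apply: contraTT; rewrite -!leqNgt leq_eqVlt => /predU1P [/val_inj ->|/f_incr/ltnW].
Qed.

(** The shuffles represent the left cosets of [S_n x S_m] in [S_(n+m)]: within
    a coset, the values on each half can be put in increasing order in only
    one way. *)
Lemma shuffle_decomp_uniq (u u' : 'S_(n + m)) a b a' b' :
  u \in shuffles n m -> u' \in shuffles n m ->
  perm_prod a b * u = perm_prod a' b' * u' -> a = a' /\ b = b'.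
Proof.
move=> /shufflesP [uL uR] /shufflesP [uL' uR'] eq_w.
have def_u' : u' = perm_prod (a'^-1 * a) (b'^-1 * b) * u.
  rewrite perm_prodM -mulgA eq_w mulgA -perm_prodM !mulVg perm_prod1.
  by rewrite mul1g.
have /(canRL (mulKVg _)) -> : a'^-1 * a = 1.
  by apply: (incr_reparam1 uL uL') => i; rewrite def_u' permM perm_prodL.
have /(canRL (mulKVg _)) -> : b'^-1 * b = 1.
  by apply: (incr_reparam1 uR uR') => i; rewrite def_u' permM perm_prodR.
by rewrite !mulg1.
Qed.

(** By [tperm_succ_lt] the exchange reverses only the comparison of [i] with
    [j], and no half takes both values. *)
Lemma shuffle_tperm (u : 'S_(n + m)) (i j : 'I_(n + m)) :
  u \in shuffles n m -> j = i.+1 :> nat ->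
  (forall p q : 'I_n, ~ (u (lshift m p) = i /\ u (lshift m q) = j)) ->
  (forall p q : 'I_m, ~ (u (rshift n p) = i /\ u (rshift n q) = j)) ->
  u * tperm i j \in shuffles n m.
Proof.
move=> /shufflesP [uL uR] ij notL notR; apply/shufflesP.
split=> p q pq; rewrite !permM tperm_succ_lt //.
- exact: uL.
- by apply/negP => /andP [/eqP pi /eqP qj]; case: (notL p q).
- exact: uR.
- by apply/negP => /andP [/eqP pi /eqP qj]; case: (notR p q).
Qed.

Section Coloured.
Variable gT : finGroupType.
Implicit Types (a : wreath gT n) (b : wreath gT m).

Lemma wprod_colL a b i : wcol (wprod a b) (lshift m i) = wcol a i.
Proof. by rewrite ffunE (unsplitK (inl i)). Qed.

Lemma wprod_colR a b i : wcol (wprod a b) (rshift n i) = wcol b i.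
Proof. by rewrite ffunE (unsplitK (inr i)). Qed.

Lemma wprod_wsym s t a b :
  wprod (wsym s * a) (wsym t * b) = wsym (perm_prod s t) * wprod a b.
Proof. by rewrite !wsym_mulE /wprod /= perm_prodM. Qed.

Lemma wprod_tpermL i j a b :
  wprod (wsym (tperm i j) * a) b =
  wsym (tperm (lshift m i) (lshift m j)) * wprod a b.
Proof.
by rewrite -perm_prod_tpermL -wprod_wsym; congr wprod; rewrite wsym_mulE mulg1; case: b.
Qed.

Lemma wprod_tpermR i j a b :
  wprod a (wsym (tperm i j) * b) =
  wsym (tperm (rshift n i) (rshift n j)) * wprod a b.
Proof.
by rewrite -perm_prod_tpermR -wprod_wsym; congr wprod; rewrite wsym_mulE mulg1; case: a.
Qed.

Lemma wsym_tpermM (u : 'S_(n + m)) i j (x : wreath gT (n + m)) :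
  wsym (tperm (u i) (u j)) * (wsym u * x) = wsym u * (wsym (tperm i j) * x).
Proof. by rewrite !mulgA -!wsym_mul -tpermJ -conjgC. Qed.

Lemma mul_wsymV (u : 'S_(n + m)) (x : wreath gT (n + m)) :
  x * (wsym u)^-1 = Wreath (u^-1 * wperm x) [ffun i => wcol x (u^-1 i)].
Proof.
apply: (canLR (mulgK _)); rewrite wreath_mulE /= mulKVg; case: x => s g /=.
by congr Wreath; apply/ffunP => i; rewrite !ffunE permK mulg1.
Qed.

Lemma mul_wsymV_col (u : 'S_(n + m)) (x : wreath gT (n + m)) i :
  wcol (x * (wsym u)^-1) (u i) = wcol x i.
Proof. by rewrite mul_wsymV ffunE permK. Qed.

Lemma mul_wsymV_perm (u : 'S_(n + m)) (x : wreath gT (n + m)) :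
  wperm (x * (wsym u)^-1) = u^-1 * wperm x.
Proof. by rewrite mul_wsymV. Qed.

End Coloured.
End Product.

(** * Passing from a graded map to its rainbow version *)

Section Transfer.
Variables (gT : finGroupType) (E : nat -> Type) (rho : forall n, 'S_n -> E n).
Variables (n m : nat).
Implicit Types (a : wreath gT n) (b : wreath gT m).

(** What the induction property says about a single decomposition: as the
    classes of [s] and [t] induce a union of fibres, the second permutation is
    also obtained from these classes, and by uniqueness only through [s'] and
    [t']. *)
Lemma induction_property_fibre (u : 'S_(n + m)) (s s' : 'S_n) (t t' : 'S_m) :
  induction_property (on_trivial rho) -> u \in shuffles n m ->
  rho (perm_prod s t * u) = rho (perm_prod s' t' * u) ->
  rho s = rho s' /\ rho t = rho t'.
Proof.
move=> IP u_sh eq_rho; case: (IP n m (rho s) (rho t)) => X defX.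
pose triv k (c : 'S_k) : wreath unit k := Wreath c [ffun=> tt].
have: (\bigcup_(e in X) [set w | on_trivial rho w = e])%classic
    (triv _ (perm_prod s t * u)).
  by rewrite -defX; exists u, (triv _ s), (triv _ t); split.
case=> e Xe /= rho_e.
have: (\bigcup_(e in X) [set w | on_trivial rho w = e])%classic
    (triv _ (perm_prod s' t' * u)).
  by exists e => //=; rewrite -rho_e /on_trivial /= eq_rho.
rewrite -defX => -[u1 [a1 [b1 [u1_sh <- <-]]]].
by rewrite wsym_mulE => -[/(shuffle_decomp_uniq u_sh u1_sh) [-> ->] _].
Qed.

(** A step of [u (a x b)] between letters of the first half is a step of [a],
    since the positions of [a] form an interval, and its factors are the traces
    of the factors of the whole word. *)
Lemma rainbow_step_unshuffleL (u : 'S_(n + m)) a b i j (w := wsym u * wprod a b) :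
  induction_property (on_trivial rho) -> u \in shuffles n m ->
  u (lshift m j) = (u (lshift m i)).+1 :> nat ->
  rainbow_index w (u (lshift m i)) <> rainbow_index w (u (lshift m j)) \/
    rainbow_index w (u (lshift m i)) = rainbow_index w (u (lshift m j)) /\
    rho (wperm w * tperm (u (lshift m i)) (u (lshift m j))) = rho (wperm w) ->
  rainbow_step rho a (wsym (tperm i j) * a).
Proof.
move=> IP u_sh ij ww'; have /shufflesP [uL uR] := u_sh.
exists i, j; split=> //; first exact: incr_succ uL ij.
have [eq_ij|] := eqVneq (rainbow_index a i) (rainbow_index a j);
  last by move/eqP; left.
right; split=> //; case: ww' => [[]|[_]].
  rewrite !rainbow_index_step.
  apply: (factor_same_factor (f := @lshift n m)) eq_ij.
  - by [].
  - exact: wprod_colL.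
  - by move=> p; rewrite perm_prodL.
  - move=> p q k /andP [_ kq].
    by exists (Ordinal (leq_ltn_trans kq (ltn_ord q))); apply: val_inj.
rewrite /w wsym_mulE /= -mulgA -tpermJ -conjgC mulgA.
by rewrite -perm_prod_tpermL -perm_prodM mulg1 => /(induction_property_fibre IP u_sh) [].
Qed.

Lemma rainbow_step_unshuffleR (u : 'S_(n + m)) a b i j (w := wsym u * wprod a b) :
  induction_property (on_trivial rho) -> u \in shuffles n m ->
  u (rshift n j) = (u (rshift n i)).+1 :> nat ->
  rainbow_index w (u (rshift n i)) <> rainbow_index w (u (rshift n j)) \/
    rainbow_index w (u (rshift n i)) = rainbow_index w (u (rshift n j)) /\
    rho (wperm w * tperm (u (rshift n i)) (u (rshift n j))) = rho (wperm w) ->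
  rainbow_step rho b (wsym (tperm i j) * b).
Proof.
move=> IP u_sh ij ww'; have /shufflesP [uL uR] := u_sh.
exists i, j; split=> //; first exact: incr_succ uR ij.
have [eq_ij|] := eqVneq (rainbow_index b i) (rainbow_index b j);
  last by move/eqP; left.
right; split=> //; case: ww' => [[]|[_]].
  rewrite !rainbow_index_step.
  apply: (factor_same_factor (f := @rshift n m)) eq_ij.
  - by move=> p q; rewrite ltn_add2l.
  - exact: wprod_colR.
  - by move=> p; rewrite perm_prodR.
  - move=> p q k /andP [pk _]; case: (split_ordP k) pk => [k0 ->|k0 ->] pk.
      by have := leq_ltn_trans (leq_trans (leq_addr p n) pk) (ltn_ord k0); rewrite ltnn.
    by exists k0.
rewrite /w wsym_mulE /= -mulgA -tpermJ -conjgC mulgA.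
by rewrite -perm_prod_tpermR -perm_prodM mulg1 => /(induction_property_fibre IP u_sh) [].
Qed.

(** Hence the set induced by two rainbow classes is closed under steps: a step
    changes either the shuffle alone or one of the two constituents inside its
    class. *)
Lemma rainbow_step_shuffle (u : 'S_(n + m)) a b (y : wreath gT (n + m)) :
  induction_property (on_trivial rho) -> u \in shuffles n m ->
  rainbow_step rho (wsym u * wprod a b) y ->
  exists u' a' b', [/\ u' \in shuffles n m,
    rainbow_proj rho a' = rainbow_proj rho a,
    rainbow_proj rho b' = rainbow_proj rho b & y = wsym u' * wprod a' b'].
Proof.
move=> IP u_sh [i [j [ij -> {y} ww']]].
pose same_half := (exists p q : 'I_n, u (lshift m p) = i /\ u (lshift m q) = j)
  \/ (exists p q : 'I_m, u (rshift n p) = i /\ u (rshift n q) = j).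
(* The letters [i] and [j] come from different halves: modify the shuffle. *)
have [|mixed] := pselect same_half; last first.
  exists (u * tperm i j), a, b; split=> //; last by rewrite wsym_mul mulgA.
  by apply: shuffle_tperm => // p q pq; apply: mixed; [left | right]; exists p, q.
case=> -[p [q [def_i def_j]]]; subst i j.
  exists u, (wsym (tperm p q) * a), b; split=> //.
    by apply/esym/rainbow_projP/rt_step/(rainbow_step_unshuffleL IP u_sh ij ww').
  by rewrite wprod_tpermL wsym_tpermM.
exists u, a, (wsym (tperm p q) * b); split=> //.
  by apply/esym/rainbow_projP/rt_step/(rainbow_step_unshuffleR IP u_sh ij ww').
by rewrite wprod_tpermR wsym_tpermM.
Qed.

Lemma restriction_property_fibre (u : 'S_(n + m)) (s s' : 'S_n) (t t' : 'S_m) :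
  restriction_property (on_trivial rho) -> u \in shuffles n m ->
  rho s = rho s' -> rho t = rho t' ->
  rho (u^-1 * perm_prod s t) = rho (u^-1 * perm_prod s' t').
Proof.
move=> RP u_sh eq_s eq_t; pose triv k (c : 'S_k) : wreath unit k := Wreath c [ffun=> tt].
have := RP n m u u_sh (triv _ s) (triv _ s') (triv _ t) (triv _ t') eq_s eq_t.
by rewrite /on_trivial !mul_wsymV.
Qed.

(** Letters that share a factor of [(a x b) u^-1] share one in [a], as [u] is
    increasing on the first half; thus a free step of [a] remains free, and
    the other ones preserve [rho] by the restriction property. *)
Lemma rainbow_step_restrictL (u : 'S_(n + m)) a a' b :
  restriction_property (on_trivial rho) -> u \in shuffles n m ->
  rainbow_step rho a a' ->
  rainbow_step rho (wprod a b * (wsym u)^-1) (wprod a' b * (wsym u)^-1).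
Proof.
move=> RP u_sh [i [j [ij -> {a'} aa']]]; have /shufflesP [uL _] := u_sh.
set y := wprod a b * _; exists (lshift m i), (lshift m j); split=> //.
  by rewrite wprod_tpermL mulgA.
have [eq_y|] := eqVneq (rainbow_index y (lshift m i)) (rainbow_index y (lshift m j));
  last by move/eqP; left.
right; split=> //; case: aa' => [[]|[_ eq_rho]].
  apply: (subword_same_factor uL) eq_y => p.
    by rewrite mul_wsymV_col wprod_colL.
  by rewrite mul_wsymV_perm permM permK perm_prodL.
rewrite mul_wsymV_perm -mulgA -perm_prod_tpermL -perm_prodM mulg1.
exact: restriction_property_fibre.
Qed.

Lemma rainbow_step_restrictR (u : 'S_(n + m)) a b b' :
  restriction_property (on_trivial rho) -> u \in shuffles n m ->
  rainbow_step rho b b' ->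
  rainbow_step rho (wprod a b * (wsym u)^-1) (wprod a b' * (wsym u)^-1).
Proof.
move=> RP u_sh [i [j [ij -> {b'} bb']]]; have /shufflesP [_ uR] := u_sh.
set y := wprod a b * _; exists (rshift n i), (rshift n j); split=> //.
- by rewrite /= ij addnS.
- by rewrite wprod_tpermR mulgA.
have [eq_y|] := eqVneq (rainbow_index y (rshift n i)) (rainbow_index y (rshift n j));
  last by move/eqP; left.
right; split=> //; case: bb' => [[]|[_ eq_rho]].
  apply: (subword_same_factor uR) eq_y => p.
    by rewrite mul_wsymV_col wprod_colR.
  by rewrite mul_wsymV_perm permM permK perm_prodR.
rewrite mul_wsymV_perm -mulgA -perm_prod_tpermR -perm_prodM mulg1.
exact: restriction_property_fibre.
Qed.

End Transfer.

(** A set closed under steps is a union of classes: take the classes that it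
    meets. *)
Lemma rainbow_induction (gT : finGroupType) (E : nat -> Type)
    (rho : forall n, 'S_n -> E n) :
  induction_property (on_trivial rho) ->
  induction_property (@rainbow_proj gT E rho).
Proof.
move=> IP n m e1 e2; set A := (X in exists _, X = _).
exists (@rainbow_proj gT E rho (n + m) @` A)%classic.
apply/seteqP; split=> [w Aw|w [_ [x Ax <-] /=]].
  by exists (rainbow_proj rho w) => //; exists w.
move/esym/rainbow_projP => xw; elim: xw Ax => // {w} {}x y; last by auto.
move=> xy [u [a [b [u_sh a_e1 b_e2 def_x]]]]; rewrite {}def_x in xy.
have [u' [a' [b' [u'_sh a'a b'b ->]]]] := rainbow_step_shuffle IP u_sh xy.
by exists u', a', b'; split; rewrite ?a'a ?b'b.
Qed.

Lemma rainbow_restriction (gT : finGroupType) (E : nat -> Type)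
    (rho : forall n, 'S_n -> E n) :
  restriction_property (on_trivial rho) ->
  restriction_property (@rainbow_proj gT E rho).
Proof.
move=> RP n m u u_sh a1 a2 b1 b2 /rainbow_projP a12 /rainbow_projP b12.
apply/rainbow_projP/(@rt_trans _ _ _ (wprod a2 b1 * (wsym u)^-1)).
  elim: a12 => {a1 a2} [a1 a2 a12|a|a1 a2 a3 _ IH12 _ IH23].
  - by apply/rt_step/rainbow_step_restrictL.
  - exact: rt_refl.
  - exact: rt_trans IH12 IH23.
elim: b12 => {b1 b2} [b1 b2 b12|b|b1 b2 b3 _ IH12 _ IH23].
- by apply/rt_step/rainbow_step_restrictR.
- exact: rt_refl.
- exact: rt_trans IH12 IH23.
Qed.

Theorem theorem3p7 (gT : finGroupType) (abG : abelian [set: gT])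
    (E : nat -> Type) (rho : forall n : nat, 'S_n -> E n)
    (rho_connected : graded_connected (@on_trivial E rho)) :
  (induction_property (@on_trivial E rho) ->
   induction_property (@rainbow_proj gT E rho)) /\
  (restriction_property (@on_trivial E rho) ->
   restriction_property (@rainbow_proj gT E rho)).
Proof.
by split; [exact: rainbow_induction | exact: rainbow_restriction].
Qed.
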